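(* Let $A\in\mathrm{End}(\mathbb C^n\otimes\mathbb C^n)$ and $B\in\mathrm{End}(\mathbb C^m\otimes\mathbb C^m)$ be idempotents, let $\mathfrak R$ be an associative unital algebra over $\mathbb C$ and let $M=(M^i_j)$ be an $n\times m$ matrix with entries $M^i_j\in\mathfrak R$. Let $x^1,\dots,x^m$ be the generators of $\mathfrak X_B(\mathbb C)$ and $\psi_1,\dots,\psi_n$ the generators of $\Xi_A(\mathbb C)$. Put $$y^i=\sum_{j=1}^mM^i_jx^j\in\mathfrak X_B(\mathfrak R),\quad i=1,\dots,n,\qquad \phi_j=\sum_{i=1}^n\psi_iM^i_j\in\Xi_A(\mathfrak R),\quad j=1,\dots,m,$$ and $Y=\sum_{i=1}^ny^ie_i$, $\Phi=\sum_{j=1}^m\phi_je^j$. Then the following three conditions are equivalent: (1) $A\,M^{(1)}M^{(2)}(1-B)=0$; (2) $A(Y\otimes Y)=0$; (3) $(\Phi\otimes\Phi)(1-B)=0$.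
   Context: $(e_i)$ and $(e^i)$ are the standard dual bases of the column space $\mathbb C^n$ and the row space $(\mathbb C^n)^*$. Entries of an operator $A\in\mathrm{End}(\mathbb C^n\otimes\mathbb C^n)$ are defined by $A(e_i\otimes e_j)=\sum_{k,l}A^{kl}_{ij}\,e_k\otimes e_l$. For an idempotent $A\in\mathrm{End}(\mathbb C^n\otimes\mathbb C^n)$: $\mathfrak X_A(\mathbb C)$ is the unital associative algebra over $\mathbb C$ generated by $x^1,\dots,x^n$ with relations $\sum_{i,j=1}^nA^{kl}_{ij}x^ix^j=0$ for all $k,l$; $\Xi_A(\mathbb C)$ is the unital associative algebra generated by $\psi_1,\dots,\psi_n$ with relations $\psi_i\psi_j=\sum_{k,l=1}^nA^{kl}_{ij}\psi_k\psi_l$ for all $i,j$. For an algebra $\mathfrak R$ put $\mathfrak X_A(\mathfrak R)=\mathfrak R\otimes\mathfrak X_A(\mathbb C)$ and $\Xi_A(\mathfrak R)=\mathfrak R\otimes\Xi_A(\mathbb C)$, so the generators commute with the elements of $\mathfrak R$. Here $Y\otimes Y=\sum_{i,j}y^iy^j\,(e_i\otimes e_j)$ and $\Phi\otimes\Phi=\sum_{i,j}\phi_i\phi_j\,(e^i\otimes e^j)$; operators act on columns from the left and on rows from the right. The operator $M^{(1)}M^{(2)}\in\mathfrak R\otimes\mathrm{Hom}(\mathbb C^m\otimes\mathbb C^m,\mathbb C^n\otimes\mathbb C^n)$ has entries $(M^{(1)}M^{(2)})^{ij}_{kl}=M^i_kM^j_l$. *)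

(* Defs.v *)
From HB Require Import structures.
From mathcomp Require Import all_boot all_algebra generic_quotient.
From mathcomp Require Import boolp reals.
From mathcomp Require Import complex mxtens.
From mathcomp Require Import xfinmap monalg.

Set Implicit Arguments.
Unset Strict Implicit.
Unset Printing Implicit Defensive.

Import GRing.Theory.
Local Open Scope ring_scope.
Local Open Scope quotient_scope.

(* Unital associative algebras over a commutative ring K, presented by the    *)
(* structure map K -> center of A.  MathComp's algType cannot be used because *)
(* it requires 1 != 0: it excludes the zero algebra, and a quotient by an     *)
(* arbitrary ideal or a tensor product need not be nonzero.                   *)
HB.mixin Record PzRing_isPzAlgebra (K : comNzRingType) A of GRing.PzRing A := {
  pzalg : K -> A;
  pzalg1 : pzalg 1 = 1;
  pzalgD : {morph pzalg : a b / a + b};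
  pzalgM : {morph pzalg : a b / a * b};
  pzalgC : forall (a : K) (x : A), pzalg a * x = x * pzalg a
}.

#[short(type="pzAlgType")]
HB.structure Definition PzAlgebra (K : comNzRingType) :=
  {A of GRing.PzRing A & PzRing_isPzAlgebra K A}.

Section AlgTypeIsPzAlgebra.
Variables (K : comNzRingType) (A : algType K).

Let in_algD : {morph (fun a : K => a%:A : A) : a b / a + b}.
Proof. by move=> a b; rewrite scalerDl. Qed.

Let in_algM : {morph (fun a : K => a%:A : A) : a b / a * b}.
Proof. by move=> a b; rewrite -scalerAl mul1r scalerA. Qed.

Let in_algC (a : K) (x : A) : a%:A * x = x * a%:A.
Proof. by rewrite -scalerAl -scalerAr mul1r mulr1. Qed.

HB.instance Definition _ :=
  PzRing_isPzAlgebra.Build K A (scale1r 1) in_algD in_algM in_algC.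
End AlgTypeIsPzAlgebra.

Section PzAlgebraTheory.
Variables (K : comNzRingType) (A : pzAlgType K).

Lemma pzalg0 : pzalg 0 = 0 :> A.
Proof. by apply: (addrI (pzalg 0)); rewrite -pzalgD !addr0. Qed.

Lemma pzalgN (a : K) : pzalg (- a) = - pzalg a :> A.
Proof. by apply: (addrI (pzalg a)); rewrite -pzalgD !subrr pzalg0. Qed.
End PzAlgebraTheory.

Section FreeAlgebra.
Variables (K : comNzRingType) (I : choiceType).
Local Notation F := {malg K[{fmonom I}]}.

Let freeC (a : K) (x : F) : a%:MP * x = x * a%:MP.
Proof.
rewrite mul_malgC [in LHS](monalgE x) [in RHS](monalgE x).
rewrite scaler_sumr mulr_suml; apply: eq_bigr => k _.
rewrite -mul_malgC !malgM_def !fgmulUU.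
by rewrite mulrC; congr << _ *g _ >>; rewrite mul1m mulm1.
Qed.

HB.instance Definition _ :=
  PzRing_isPzAlgebra.Build K F (rmorph1 _) (rmorphD _) (rmorphM _) freeC.

Definition free_gen (i : I) : F := << fmu i >>.
End FreeAlgebra.

Section QuotientByIdeal.
Variables (A : pzRingType) (S : A -> Prop).

(* Closure under negation is the case u = - 1, w = 1 of the last clause.      *)
Definition two_sided_ideal (I : A -> Prop) : Prop :=
  [/\ I 0, forall u v, I u -> I v -> I (u + v)
    & forall u v w, I v -> I (u * v * w)].

Definition gen_ideal (u : A) : Prop :=
  forall I : A -> Prop, two_sided_ideal I -> (forall s, S s -> I s) -> I u.

Lemma gen_ideal_ideal : two_sided_ideal gen_ideal.
Proof.
split=> [I [I0 _ _] _ //|u v Iu Iv I iI sI|u v w Iv I iI sI].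
  by case: (iI) => _ ID _; apply: ID; [apply: Iu|apply: Iv].
by case: (iI) => _ _ IM; apply: IM; apply: Iv.
Qed.

Lemma gen_ideal_sub s : S s -> gen_ideal s.
Proof. by move=> Ss I _; apply. Qed.

Let ideal0 : gen_ideal 0. Proof. by case: gen_ideal_ideal. Qed.
Let idealD u v : gen_ideal u -> gen_ideal v -> gen_ideal (u + v).
Proof. by have [_ + _] := gen_ideal_ideal; apply. Qed.
Let idealMl u v : gen_ideal v -> gen_ideal (u * v).
Proof.
by have [_ _ IM] := gen_ideal_ideal => Iv; rewrite -[u * v]mulr1; apply: IM.
Qed.
Let idealMr u v : gen_ideal u -> gen_ideal (u * v).
Proof.
by have [_ _ IM] := gen_ideal_ideal => Iu; rewrite -[u]mul1r; apply: IM.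
Qed.
Let idealN u : gen_ideal u -> gen_ideal (- u).
Proof. by move=> Iu; rewrite -mulN1r; apply: idealMl. Qed.

Definition quot_rel : rel A := fun u v => `[< gen_ideal (u - v) >].

Lemma quot_rel_is_equiv : equiv_class_of quot_rel.
Proof.
split=> [u|u v|v u w].
- by apply/asboolP; rewrite subrr.
- by apply/asboolP/asboolP => /idealN; rewrite opprB.
- move=> /asboolP uv /asboolP vw; apply/asboolP.
  by rewrite -[u](subrK v) -addrA; apply: idealD.
Qed.

Canonical quot_equiv := EquivRelPack quot_rel_is_equiv.

Definition quot_ring : Type := {eq_quot quot_rel}.
HB.instance Definition _ := Choice.on quot_ring.
HB.instance Definition _ := EqQuotient.on quot_ring.

Definition quot_pi (u : A) : quot_ring := \pi_quot_ring u.

Lemma quot_piW (P : quot_ring -> Prop) :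
  (forall u, P (quot_pi u)) -> forall x, P x.
Proof. by move=> Pu x; rewrite -[x]reprK; apply: Pu. Qed.

Lemma quotP_ideal (u v : A) :
  quot_pi u = quot_pi v <-> gen_ideal (u - v).
Proof.
by split=> [/eqquotP/asboolP //|uv]; apply/eqquotP/asboolP.
Qed.

Definition quot_zero : quot_ring := quot_pi 0.
Definition quot_one : quot_ring := quot_pi 1.
Definition quot_opp (x : quot_ring) : quot_ring := quot_pi (- repr x).
Definition quot_add (x y : quot_ring) : quot_ring := quot_pi (repr x + repr y).
Definition quot_mul (x y : quot_ring) : quot_ring := quot_pi (repr x * repr y).

Let ideal_repr (u : A) : gen_ideal (repr (quot_pi u) - u).
Proof. by apply/quotP_ideal; rewrite /quot_pi reprK. Qed.

Let pi_opp u : quot_opp (quot_pi u) = quot_pi (- u).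
Proof. by apply/quotP_ideal; rewrite -opprD; apply: idealN (ideal_repr u). Qed.

Let pi_add u v : quot_add (quot_pi u) (quot_pi v) = quot_pi (u + v).
Proof.
apply/quotP_ideal; rewrite opprD addrACA.
by apply: idealD; apply: ideal_repr.
Qed.

Let pi_mul u v : quot_mul (quot_pi u) (quot_pi v) = quot_pi (u * v).
Proof.
apply/quotP_ideal; set u' := repr _; set v' := repr _.
have -> : u' * v' - u * v = (u' - u) * v' + u * (v' - v).
  by rewrite mulrBl mulrBr addrA subrK.
by apply: idealD; [apply: idealMr|apply: idealMl]; apply: ideal_repr.
Qed.

Let quot_addA : associative quot_add.
Proof.
by elim/quot_piW=> x; elim/quot_piW=> y; elim/quot_piW=> z;
rewrite !pi_add addrA.
Qed.
Let quot_addC : commutative quot_add.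
Proof. by elim/quot_piW=> x; elim/quot_piW=> y; rewrite !pi_add addrC. Qed.
Let quot_add0 : left_id quot_zero quot_add.
Proof. by elim/quot_piW=> x; rewrite pi_add add0r. Qed.
Let quot_addN : left_inverse quot_zero quot_opp quot_add.
Proof. by elim/quot_piW=> x; rewrite pi_opp pi_add addNr. Qed.

HB.instance Definition _ :=
  GRing.isZmodule.Build quot_ring quot_addA quot_addC quot_add0 quot_addN.

Let quot_mulA : associative quot_mul.
Proof.
by elim/quot_piW=> x; elim/quot_piW=> y; elim/quot_piW=> z;
rewrite !pi_mul mulrA.
Qed.
Let quot_mul1x : left_id quot_one quot_mul.
Proof. by elim/quot_piW=> x; rewrite pi_mul mul1r. Qed.
Let quot_mulx1 : right_id quot_one quot_mul.
Proof. by elim/quot_piW=> x; rewrite pi_mul mulr1. Qed.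
Let quot_mulDl : left_distributive quot_mul quot_add.
Proof.
by elim/quot_piW=> x; elim/quot_piW=> y; elim/quot_piW=> z;
rewrite !(pi_add, pi_mul) mulrDl.
Qed.
Let quot_mulDr : right_distributive quot_mul quot_add.
Proof.
by elim/quot_piW=> x; elim/quot_piW=> y; elim/quot_piW=> z;
rewrite !(pi_add, pi_mul) mulrDr.
Qed.

HB.instance Definition _ := GRing.Zmodule_isPzRing.Build quot_ring
  quot_mulA quot_mul1x quot_mulx1 quot_mulDl quot_mulDr.

Lemma quot_pi0 : quot_pi 0 = 0. Proof. by []. Qed.
Lemma quot_pi1 : quot_pi 1 = 1. Proof. by []. Qed.
Lemma quot_piD : {morph quot_pi : u v / u + v}.
Proof. by move=> u v; rewrite -pi_add. Qed.
Lemma quot_piN : {morph quot_pi : u / - u}.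
Proof. by move=> u; rewrite -pi_opp. Qed.
Lemma quot_piM : {morph quot_pi : u v / u * v}.
Proof. by move=> u v; rewrite -pi_mul. Qed.
Lemma quot_piP (u : A) : quot_pi u = 0 <-> gen_ideal u.
Proof. by rewrite -[u in gen_ideal u]subr0 -quotP_ideal. Qed.
End QuotientByIdeal.

Section QuotientAlgebra.
Variables (K : comNzRingType) (A : pzAlgType K) (S : A -> Prop).
Local Notation Q := (quot_ring S).

Let in_quot (a : K) : Q := quot_pi S (pzalg a).

Let in_quot1 : in_quot 1 = 1.
Proof. by rewrite /in_quot pzalg1. Qed.
Let in_quotD : {morph in_quot : a b / a + b}.
Proof. by move=> a b; rewrite /in_quot pzalgD quot_piD. Qed.
Let in_quotM : {morph in_quot : a b / a * b}.
Proof. by move=> a b; rewrite /in_quot pzalgM quot_piM. Qed.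
Let in_quotC (a : K) (x : Q) : in_quot a * x = x * in_quot a.
Proof. by elim/quot_piW: x => x; rewrite -!quot_piM pzalgC. Qed.

HB.instance Definition _ :=
  PzRing_isPzAlgebra.Build K Q in_quot1 in_quotD in_quotM in_quotC.
End QuotientAlgebra.

(* The tensor product over K of two K-algebras.  Its elements are the formal  *)
(* sums r_1 (x) s_1 + ... + r_k (x) s_k, represented by sequences of pairs,   *)
(* modulo the identities that hold for every K-bilinear map out of R x S;     *)
(* scalars need not appear in formal sums since a (r (x) s) = (a r) (x) s.    *)
Section Tensor.
Variables (K : comNzRingType) (R S : pzAlgType K).

Definition bilinear_map (V : lmodType K) (b : R -> S -> V) : Prop :=
  [/\ forall r r' s, b (r + r') s = b r s + b r' s,
      forall r s s', b r (s + s') = b r s + b r s',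
      forall a r s, b (pzalg a * r) s = a *: b r s
    & forall a r s, b r (pzalg a * s) = a *: b r s].

Local Notation fsum := (seq (R * S)).

Definition tens_eval (V : lmodType K) (b : R -> S -> V) (t : fsum) : V :=
  \sum_(p <- t) b p.1 p.2.

Definition tens_eq (t u : fsum) : Prop :=
  forall (V : lmodType K) (b : R -> S -> V),
    bilinear_map b -> tens_eval b t = tens_eval b u.

Definition tens_rel : rel fsum := fun t u => `[< tens_eq t u >].

Lemma tens_rel_is_equiv : equiv_class_of tens_rel.
Proof.
split=> [t|t u|t u v].
- by apply/asboolP.
- by apply/asboolP/asboolP => tu V b bb; rewrite tu.
- by move=> /asboolP tu /asboolP uv; apply/asboolP => V b bb; rewrite tu ?uv.
Qed.

Canonical tens_equiv := EquivRelPack tens_rel_is_equiv.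

Definition tensor : Type := {eq_quot tens_rel}.
HB.instance Definition _ := Choice.on tensor.
HB.instance Definition _ := EqQuotient.on tensor.

Definition tens_pi (t : fsum) : tensor := \pi_tensor t.

Lemma tens_piW (P : tensor -> Prop) :
  (forall t, P (tens_pi t)) -> forall x, P x.
Proof. by move=> Pt x; rewrite -[x]reprK; apply: Pt. Qed.

Definition tens_zero : tensor := tens_pi [::].
Definition tens_one : tensor := tens_pi [:: (1, 1)].
Definition tens_opp (x : tensor) : tensor :=
  tens_pi [seq (- p.1, p.2) | p <- repr x].
Definition tens_add (x y : tensor) : tensor := tens_pi (repr x ++ repr y).
Definition fsum_mul (t u : fsum) : fsum :=
  [seq (p.1 * q.1, p.2 * q.2) | p <- t, q <- u].
Definition tens_mul (x y : tensor) : tensor :=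
  tens_pi (fsum_mul (repr x) (repr y)).

Let piP (t u : fsum) : tens_eq t u -> tens_pi t = tens_pi u.
Proof. by move=> tu; apply/eqquotP/asboolP. Qed.

Let reprP (t : fsum) : tens_eq (repr (tens_pi t)) t.
Proof. by have /eqquotP/asboolP := reprK (tens_pi t). Qed.

Let bilinN (V : lmodType K) (b : R -> S -> V) r s :
  bilinear_map b -> b (- r) s = - b r s.
Proof.
case=> _ _ bZl _; rewrite -mulN1r -(pzalg1 (K := K) (s := R)) -pzalgN bZl.
by rewrite scaleN1r.
Qed.

Let eval_cat (V : lmodType K) (b : R -> S -> V) t u :
  tens_eval b (t ++ u) = tens_eval b t + tens_eval b u.
Proof. by rewrite /tens_eval big_cat. Qed.

Let eval_opp (V : lmodType K) (b : R -> S -> V) t : bilinear_map b ->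
  tens_eval b [seq (- p.1, p.2) | p <- t] = - tens_eval b t.
Proof.
move=> bb; rewrite /tens_eval big_map -sumrN.
by apply: eq_bigr => p _; rewrite bilinN.
Qed.

Let eval_mul (V : lmodType K) (b : R -> S -> V) t u :
  tens_eval b (fsum_mul t u) =
  \sum_(p <- t) \sum_(q <- u) b (p.1 * q.1) (p.2 * q.2).
Proof. by rewrite /tens_eval big_allpairs_dep. Qed.

Let pi_opp t : tens_opp (tens_pi t) = tens_pi [seq (- p.1, p.2) | p <- t].
Proof. by apply: piP => V b bb; rewrite !eval_opp // reprP. Qed.

Let pi_add t u : tens_add (tens_pi t) (tens_pi u) = tens_pi (t ++ u).
Proof. by apply: piP => V b bb; rewrite !eval_cat !reprP. Qed.

Let eq_mul t t' u u' : tens_eq t t' -> tens_eq u u' ->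
  tens_eq (fsum_mul t u) (fsum_mul t' u').
Proof.
move=> tt' uu' V b bb; case: (bb) => bDl bDr bZl bZr; rewrite !eval_mul.
pose bl r s := \sum_(q <- u) b (r * q.1) (s * q.2).
rewrite [LHS](tt' V bl); last first.
  split=> [r r' s|r s s'|a r s|a r s]; rewrite /bl ?scaler_sumr -?big_split /=;
  by apply: eq_bigr => q _; rewrite ?mulrDl ?bDl ?bDr // -mulrA ?bZl ?bZr.
rewrite /tens_eval; apply: eq_bigr => p _; rewrite /bl.
apply: (uu' V (fun r s => b (p.1 * r) (p.2 * s))).
split=> [r r' s|r s s'|a r s|a r s]; rewrite ?mulrDr ?bDl ?bDr //.
  by rewrite mulrA -pzalgC -mulrA bZl.
by rewrite mulrA -pzalgC -mulrA bZr.
Qed.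

Let pi_mul t u : tens_mul (tens_pi t) (tens_pi u) = tens_pi (fsum_mul t u).
Proof. by apply/piP/eq_mul; apply: reprP. Qed.

Let tens_addA : associative tens_add.
Proof.
by elim/tens_piW=> x; elim/tens_piW=> y; elim/tens_piW=> z; rewrite !pi_add catA.
Qed.
Let tens_addC : commutative tens_add.
Proof.
elim/tens_piW=> x; elim/tens_piW=> y; rewrite !pi_add; apply: piP => V b _.
by rewrite !eval_cat addrC.
Qed.
Let tens_add0 : left_id tens_zero tens_add.
Proof. by elim/tens_piW=> x; rewrite pi_add. Qed.
Let tens_addN : left_inverse tens_zero tens_opp tens_add.
Proof.
elim/tens_piW=> x; rewrite pi_opp pi_add; apply: piP => V b bb.
by rewrite eval_cat eval_opp // addNr /tens_eval big_nil.
Qed.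

HB.instance Definition _ :=
  GRing.isZmodule.Build tensor tens_addA tens_addC tens_add0 tens_addN.

Let tens_mulA : associative tens_mul.
Proof.
elim/tens_piW=> x; elim/tens_piW=> y; elim/tens_piW=> z; rewrite !pi_mul.
apply: piP => V b _; rewrite !eval_mul big_allpairs_dep; apply: eq_bigr => p _.
rewrite big_allpairs_dep; apply: eq_bigr => q _.
by apply: eq_bigr => r _ /=; rewrite !mulrA.
Qed.
Let tens_mul1x : left_id tens_one tens_mul.
Proof.
elim/tens_piW=> x; rewrite pi_mul; apply: piP => V b _; rewrite eval_mul big_seq1.
by apply: eq_bigr => p _ /=; rewrite !mul1r.
Qed.
Let tens_mulx1 : right_id tens_one tens_mul.
Proof.
elim/tens_piW=> x; rewrite pi_mul; apply: piP => V b _; rewrite eval_mul.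
by apply: eq_bigr => p _ /=; rewrite big_seq1 /= !mulr1.
Qed.
Let tens_mulDl : left_distributive tens_mul tens_add.
Proof.
elim/tens_piW=> x; elim/tens_piW=> y; elim/tens_piW=> z; rewrite !(pi_add, pi_mul).
by apply: piP => V b _; rewrite eval_cat !eval_mul big_cat.
Qed.
Let tens_mulDr : right_distributive tens_mul tens_add.
Proof.
elim/tens_piW=> x; elim/tens_piW=> y; elim/tens_piW=> z; rewrite !(pi_add, pi_mul).
apply: piP => V b _; rewrite eval_cat !eval_mul -big_split.
by apply: eq_bigr => p _; rewrite big_cat.
Qed.

HB.instance Definition _ := GRing.Zmodule_isPzRing.Build tensor
  tens_mulA tens_mul1x tens_mulx1 tens_mulDl tens_mulDr.

Definition tens (r : R) (s : S) : tensor := tens_pi [:: (r, s)].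

Lemma tens11 : tens 1 1 = 1.
Proof. by []. Qed.

Lemma tensM r r' s s' : tens r s * tens r' s' = tens (r * r') (s * s').
Proof. exact: pi_mul. Qed.

Lemma tensDl r r' s : tens (r + r') s = tens r s + tens r' s.
Proof.
rewrite [RHS]pi_add /=; apply: piP => V b [bDl _ _ _] /=.
by rewrite /tens_eval !big_cons !big_nil !addr0 bDl.
Qed.

Lemma tensDr r s s' : tens r (s + s') = tens r s + tens r s'.
Proof.
rewrite [RHS]pi_add /=; apply: piP => V b [_ bDr _ _] /=.
by rewrite /tens_eval !big_cons !big_nil !addr0 bDr.
Qed.

Lemma tensZ (a : K) r s : tens (pzalg a * r) s = tens r (pzalg a * s).
Proof.
by apply: piP => V b [_ _ bZl bZr]; rewrite /tens_eval !big_seq1 bZl bZr.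
Qed.

Let in_tens (a : K) : tensor := tens (pzalg a) 1.
Let in_tens1 : in_tens 1 = 1.
Proof. by rewrite /in_tens pzalg1. Qed.
Let in_tensD : {morph in_tens : a b / a + b}.
Proof. by move=> a b; rewrite /in_tens pzalgD tensDl. Qed.
Let in_tensM : {morph in_tens : a b / a * b}.
Proof. by move=> a b; rewrite /in_tens pzalgM tensM mulr1. Qed.
Let in_tensC (a : K) (x : tensor) : in_tens a * x = x * in_tens a.
Proof.
elim/tens_piW: x => x; rewrite [LHS]pi_mul [RHS]pi_mul; apply: piP => V b _.
rewrite !eval_mul big_seq1; apply: eq_bigr => p _ /=.
by rewrite big_seq1 /= pzalgC mul1r mulr1.
Qed.

HB.instance Definition _ :=
  PzRing_isPzAlgebra.Build K tensor in_tens1 in_tensD in_tensM in_tensC.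

Lemma tens_span (x : tensor) :
  exists t : seq (R * S), x = \sum_(p <- t) tens p.1 p.2.
Proof.
elim/tens_piW: x => x; exists x; elim: x => [|[r s] x IH]; first by rewrite big_nil.
by rewrite big_cons -IH [RHS]pi_add.
Qed.

Definition tens_lift (V : lmodType K) (b : R -> S -> V) (x : tensor) : V :=
  tens_eval b (repr x).

Lemma tens_liftE (V : lmodType K) (b : R -> S -> V) r s :
  bilinear_map b -> tens_lift b (tens r s) = b r s.
Proof. by move=> bb; rewrite /tens_lift reprP // /tens_eval big_seq1. Qed.

Lemma tens_liftD (V : lmodType K) (b : R -> S -> V) : bilinear_map b ->
  {morph tens_lift b : x y / x + y}.
Proof.
move=> bb; elim/tens_piW=> x; elim/tens_piW=> y.
by rewrite [_ + _]pi_add /tens_lift !reprP // eval_cat.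
Qed.

Lemma tens_liftZ (V : lmodType K) (b : R -> S -> V) (a : K) (x : tensor) :
  bilinear_map b -> tens_lift b (pzalg a * x) = a *: tens_lift b x.
Proof.
move=> bb; elim/tens_piW: x => x; rewrite [_ * _]pi_mul /tens_lift !reprP //.
case: bb => _ _ bZl _; rewrite eval_mul big_seq1 /tens_eval scaler_sumr.
by apply: eq_bigr => p _ /=; rewrite mul1r bZl.
Qed.
End Tensor.

(* The entry of A with upper indices k, l and lower indices i, j.  Operators  *)
(* K^m (x) K^m -> K^n (x) K^n are matrices 'M_(n * n, m * m), with the pair   *)
(* numbering of mxtens; thus tensmx gives M^(1) M^(2) = M *t M, and also      *)
(* Y (x) Y = Y *t Y for columns and rows (note that 1 * 1 converts to 1).     *)
Definition entry4 (T : Type) (n m : nat) (A : 'M[T]_(n * n, m * m))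
    (k l : 'I_n) (i j : 'I_m) : T :=
  A (mxtens_index (k, l)) (mxtens_index (i, j)).

Section QuadraticAlgebras.
Variables (K : comNzRingType) (n : nat) (A : 'M[K]_(n * n)).
Local Notation F := {malg K[{fmonom 'I_n}]}.
Local Notation X := (free_gen K).

Definition Xalg_rel (u : F) : Prop :=
  exists k l : 'I_n, u = \sum_i \sum_j entry4 A k l i j *: (X i * X j).
Definition Xalg := quot_ring Xalg_rel.
HB.instance Definition _ := PzAlgebra.on Xalg.
Definition xgen (i : 'I_n) : Xalg := quot_pi Xalg_rel (X i).

Definition Xialg_rel (u : F) : Prop :=
  exists i j : 'I_n,
    u = X i * X j - \sum_k \sum_l entry4 A k l i j *: (X k * X l).
Definition Xialg := quot_ring Xialg_rel.
HB.instance Definition _ := PzAlgebra.on Xialg.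
Definition psigen (i : 'I_n) : Xialg := quot_pi Xialg_rel (X i).
End QuadraticAlgebras.

(* Operators with scalar entries, viewed over a K-algebra T.                  *)
Definition scalar_op (K : comNzRingType) (T : pzAlgType K) (p q : nat)
  (A : 'M[K]_(p, q)) : 'M[T]_(p, q) := map_mx (@pzalg K T) A.

Section GeneratingVectors.
Variables (K : comNzRingType) (R : pzAlgType K) (n m : nat) (M : 'M[R]_(n, m)).

Definition Yvec (B : 'M[K]_(m * m)) : 'cV[tensor R (Xalg B)]_n :=
  \col_i \sum_j tens (M i j) 1 * tens 1 (xgen B j).

Definition Phivec (A : 'M[K]_(n * n)) : 'rV[tensor R (Xialg A)]_m :=
  \row_j \sum_i tens 1 (psigen A i) * tens (M i j) 1.
End GeneratingVectors.

(* Main.v *)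
(* Put MM = M^(1) M^(2).  Collecting coefficients, A (Y (x) Y) is the sum of  *)
(* (A MM)_q (x) X_q over pairs q = (i, j), where X_q = x^i x^j.  The defining *)
(* relations give X = (1 - B) X, so the sum only depends on A MM (1 - B).     *)
(* Conversely B (1 - B) = 0 makes each column of 1 - B a well-defined linear  *)
(* functional on X_B: read off the coefficients of degree 2 and pair them     *)
(* with the column; on X_q it gives the q-th entry of the column.  Applied to *)
(* the second tensor factor, these functionals recover A MM (1 - B).  The     *)
(* condition on Phi is treated likewise: psi psi = psi psi A, and the rows of *)
(* A give functionals on Xi_A because A is idempotent.                        *)

From HB Require Import structures.
Require Import Defs.
From mathcomp Require Import all_boot all_algebra.
From mathcomp Require Import reals complex mxtens xfinmap monalg.

Set Implicit Arguments.
Unset Strict Implicit.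
Unset Printing Implicit Defensive.

Import GRing.Theory.
Local Open Scope ring_scope.

(** Each of (2) and (3) is compared with (1) through one criterion, [tens_quot_gen2_eq0]. Let [X_q]
    be the products of two generators in a quotient of the free algebra. Suppose that [X_q] is the
    sum of the [d q t X_t], and that every column of [d], paired with degree-2 coefficients, kills
    the relations, which have no terms of degree below 2. Then the sum of the [r_q (x) X_q] vanishes
    exactly when [r d = 0]. For (2), [r] is a row of [A MM] and [d = 1 - B] ([Xalg_tens_eq0]); for
    (3), [r] is a column of [MM (1 - B)] and [d] is the transpose of [A] ([Xialg_tens_eq0]).
    Idempotence makes the pairings with the relations vanish, and [quad_functional_ideal] carries
    this over to the whole ideal. *)

(** * Coefficients of products in the free algebra *)

Section FreeAlgebraCoefficients.
Variables (K : comNzRingType) (I : choiceType).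
Implicit Types (u v : {malg K[{fmonom I}]}) (w : seq I).

(** Only the cut of [w] at position [size s] can contribute. The equality is stated between numbers
    so that it can serve as a multiplicity in [mcoeffM_splits]. *)
Lemma cat_eq_splits (s t w : seq I) :
  (s ++ t == w : nat) =
  (\sum_(i < (size w).+1) (s == take i w) * (t == drop i w))%N.
Proof.
have [<-|neq_st] := eqVneq (s ++ t) w.
  have lt_s : (size s < (size (s ++ t)).+1)%N by rewrite ltnS size_cat leq_addr.
  rewrite (bigD1 (Ordinal lt_s)) //= take_size_cat // drop_size_cat // !eqxx.
  rewrite big1 // => i; rewrite -val_eqE /= => neq_is.
  case: eqP => // /(congr1 size); rewrite size_takel -1?ltnS ?ltn_ord //.
  by move=> eq_is; rewrite eq_is eqxx in neq_is.
rewrite big1 // => i _; case: eqP => // def_s; case: eqP => // def_t.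
by rewrite def_s def_t cat_take_drop eqxx in neq_st.
Qed.

Lemma mcoeff_sumE u (k : {fmonom I}) :
  u@_k = \sum_(k' <- msupp u) u@_k' *+ (k' == k).
Proof.
rewrite [in LHS](monalgE u) raddf_sum.
by apply: eq_bigr => k' _; rewrite /= mcoeffU.
Qed.

(** A word arises in a product once for each way of cutting it in two. Both sides are expanded over
    the supports of [u] and [v] and compared termwise by [cat_eq_splits]. *)
Lemma mcoeffM_splits u v w :
  (u * v)@_(FMonom w) =
  \sum_(i < (size w).+1) u@_(FMonom (take i w)) * v@_(FMonom (drop i w)).
Proof.
under eq_bigr => i _ do rewrite mcoeff_sumE [v@__]mcoeff_sumE big_distrlr /=.
rewrite mcoeffMl [RHS]exchange_big; apply: eq_bigr => k1 _ /=.
rewrite [RHS]exchange_big; apply: eq_bigr => k2 _ /=.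
rewrite fmP fmM cat_eq_splits -sumrMnr; apply: eq_bigr => i _.
by rewrite !fmP mulrnAl mulrnAr -mulrnA mulnC.
Qed.

Lemma mcoeffM_fm0 u v :
  (u * v)@_(FMonom [::]) = u@_(FMonom [::]) * v@_(FMonom [::]).
Proof. by rewrite mcoeffM_splits big_ord1. Qed.

Lemma mcoeffM_fm1 u v (a : I) :
  (u * v)@_(FMonom [:: a]) =
  u@_(FMonom [::]) * v@_(FMonom [:: a]) + u@_(FMonom [:: a]) * v@_(FMonom [::]).
Proof. by rewrite mcoeffM_splits !big_ord_recr big_ord0 /= add0r. Qed.

Lemma mcoeffM_fm2 u v (a b : I) :
  (u * v)@_(FMonom [:: a; b]) =
  u@_(FMonom [::]) * v@_(FMonom [:: a; b])
  + u@_(FMonom [:: a]) * v@_(FMonom [:: b])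
  + u@_(FMonom [:: a; b]) * v@_(FMonom [::]).
Proof. by rewrite mcoeffM_splits !big_ord_recr big_ord0 /= add0r. Qed.

Lemma mcoeff_free_gen2 (i j : I) w :
  (free_gen K i * free_gen K j)@_(FMonom w) = ([:: i; j] == w)%:R.
Proof.
by rewrite /free_gen malgM_def fgmulUU mulr1 mcoeffU1 fmP fmM !fmU.
Qed.
End FreeAlgebraCoefficients.

(** * Linear functionals on a quotient, read off in degree 2 *)

Section QuadraticFunctional.
Variables (K : comNzRingType) (n : nat).
Local Notation F := {malg K[{fmonom 'I_n}]}.
Variables (S : F -> Prop) (c : 'I_(n * n) -> K).

Definition quad_functional (u : F) : K :=
  \sum_q c q * u@_(FMonom [:: (mxtens_unindex q).1; (mxtens_unindex q).2]).

Lemma quad_functionalD : {morph quad_functional : u v / u + v}.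
Proof.
move=> u v; rewrite /quad_functional -big_split.
by apply: eq_bigr => q _; rewrite mcoeffD mulrDr.
Qed.

Lemma quad_functionalZ (a : K) u :
  quad_functional (a *: u) = a * quad_functional u.
Proof.
rewrite /quad_functional mulr_sumr.
by apply: eq_bigr => q _; rewrite mcoeffZ mulrCA.
Qed.

Lemma quad_functionalB u v :
  quad_functional (u - v) = quad_functional u - quad_functional v.
Proof. by rewrite quad_functionalD -scaleN1r quad_functionalZ mulN1r. Qed.

Lemma quad_functional_gen2 (q : 'I_(n * n)) :
  quad_functional
    (free_gen K (mxtens_unindex q).1 * free_gen K (mxtens_unindex q).2) = c q.
Proof.
rewrite /quad_functional (bigD1 q) //= mcoeff_free_gen2 eqxx mulr1.
rewrite big1 ?addr0 // => p neq_pq; rewrite mcoeff_free_gen2.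
case: eqP => [[eq1 eq2]|_]; last exact: mulr0.
case/eqP: neq_pq; apply: (can_inj (@mxtens_unindexK n n)).
rewrite [mxtens_unindex p]surjective_pairing [mxtens_unindex q]surjective_pairing.
by congr (_, _); apply: val_inj; rewrite /= ?(congr1 val eq1) ?(congr1 val eq2).
Qed.

(** Terms of degree above 2 are allowed, so that these elements form a two-sided ideal. The kernel
    of [quad_functional] alone is in general not an ideal, but its intersection with this one is. *)
Definition quadratic (u : F) : Prop :=
  u@_(FMonom [::]) = 0 /\ forall a : 'I_n, u@_(FMonom [:: a]) = 0.

Hypothesis S_quadratic : forall u, S u -> quadratic u.
Hypothesis S_functional : forall u, S u -> quad_functional u = 0.

(* If v has no terms of degree at most 1, then the quadratic part of x v y is *)
(* that of v multiplied by the constant terms of x and y.                     *)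
Lemma quad_functional_ideal u : gen_ideal S u -> quad_functional u = 0.
Proof.
move=> /(_ (fun v => quadratic v /\ quad_functional v = 0)) [].
- split=> [|v w [[v0 v1] fv] [[w0 w1] fw]|x v y [[v0 v1] fv]].
  + rewrite /quad_functional; split; first by split=> [|a]; rewrite mcoeff0.
    by rewrite big1 // => q _; rewrite mcoeff0 mulr0.
  + rewrite quad_functionalD fv fw addr0; split=> //; split=> [|a].
      by rewrite mcoeffD v0 w0 addr0.
    by rewrite mcoeffD v1 w1 addr0.
  + split; first split=> [|a].
    * by rewrite !mcoeffM_fm0 v0 mulr0 mul0r.
    * by rewrite mcoeffM_fm1 mcoeffM_fm1 mcoeffM_fm0 v0 v1 !(mulr0, mul0r, addr0).
    rewrite -[RHS](mulr0 (x@_(FMonom [::]) * y@_(FMonom [::]))) -fv.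
    rewrite /quad_functional mulr_sumr; apply: eq_bigr => q _.
    rewrite mcoeffM_fm2 mcoeffM_fm2 mcoeffM_fm1 mcoeffM_fm0 v0 !v1.
    by rewrite !(mulr0, mul0r, add0r, addr0) [RHS]mulrCA mulrAC.
- by move=> v Sv; split; [apply: S_quadratic|apply: S_functional].
by [].
Qed.

Definition quot_functional (x : quot_ring S) : K := quad_functional (repr x).

(** Two representatives of a class differ by an element of the ideal, on which the functional
    vanishes. *)
Lemma quot_functional_pi u : quot_functional (quot_pi S u) = quad_functional u.
Proof.
apply/eqP; rewrite -subr_eq0 -quad_functionalB; apply/eqP.
by apply/quad_functional_ideal/quotP_ideal; rewrite /quot_pi reprK.
Qed.

Lemma quot_functionalD : {morph quot_functional : x y / x + y}.
Proof.
elim/quot_piW=> u; elim/quot_piW=> v.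
by rewrite -quot_piD !quot_functional_pi quad_functionalD.
Qed.

Lemma quot_functionalZ (a : K) x :
  quot_functional (pzalg a * x) = a * quot_functional x.
Proof.
elim/quot_piW: x => u; rewrite -quot_piM !quot_functional_pi.
by rewrite [pzalg a]/(a%:MP) mul_malgC quad_functionalZ.
Qed.
End QuadraticFunctional.

(** * Applying functionals to the second tensor factor *)

Section PzAlgebraModule.
Variables (K : comNzRingType) (R : pzAlgType K).

(* R with its K-module structure, as a target for tens_lift. *)
Definition pz_module : Type := R.
HB.instance Definition _ := GRing.Zmodule.on pz_module.

Let pz_scale (a : K) (r : pz_module) : pz_module := pzalg a * (r : R).
Let pz_scaleA a b r : pz_scale a (pz_scale b r) = pz_scale (a * b) r.
Proof. by rewrite /pz_scale pzalgM mulrA. Qed.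
Let pz_scale1 : left_id 1 pz_scale.
Proof. by move=> r; rewrite /pz_scale pzalg1 mul1r. Qed.
Let pz_scaleDr : right_distributive pz_scale +%R.
Proof. by move=> a r s; rewrite /pz_scale mulrDr. Qed.
Let pz_scaleDl r : {morph pz_scale^~ r : a b / a + b}.
Proof. by move=> a b; rewrite /pz_scale pzalgD mulrDl. Qed.

HB.instance Definition _ := GRing.Zmodule_isLmodule.Build K pz_module
  pz_scaleA pz_scale1 pz_scaleDr pz_scaleDl.

Lemma pz_scaleE (a : K) (r : R) : a *: (r : pz_module) = pzalg a * r.
Proof. by []. Qed.
End PzAlgebraModule.

Section TensorTheory.
Variables (K : comNzRingType) (R S : pzAlgType K).

Lemma tens0l (s : S) : tens (0 : R) s = 0.
Proof. by apply: (addrI (tens 0 s)); rewrite -tensDl !addr0. Qed.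

Lemma tens0r (r : R) : tens r (0 : S) = 0.
Proof. by apply: (addrI (tens r 0)); rewrite -tensDr !addr0. Qed.

Lemma tens_suml (J : finType) (f : J -> R) (s : S) :
  tens (\sum_j f j) s = \sum_j tens (f j) s.
Proof.
by apply: (big_morph (fun r => tens r s)) => [r r'|]; rewrite ?tensDl ?tens0l.
Qed.

Lemma tens_sumr (J : finType) (r : R) (f : J -> S) :
  tens r (\sum_j f j) = \sum_j tens r (f j).
Proof. by apply: (big_morph (tens r)) => [s s'|]; rewrite ?tensDr ?tens0r. Qed.

(** By linearity of [f], the map sending [r (x) s] to [f(s) r] is bilinear, hence induces an
    additive map from the tensor product to [R], which is applied to the vanishing sum. *)
Lemma tens_sum_functional (f : S -> K) (J : finType) (r : J -> R) (s : J -> S) :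
    {morph f : x y / x + y} -> (forall a x, f (pzalg a * x) = a * f x) ->
  \sum_j tens (r j) (s j) = 0 -> \sum_j pzalg (f (s j)) * r j = 0.
Proof.
move=> fD fZ sum0; pose b (x : R) (y : S) : pz_module R := pzalg (f y) * x.
have bb : bilinear_map b.
  split=> [x x' y|x y y'|a x y|a x y]; rewrite /b ?mulrDr ?fD ?pzalgD ?mulrDl //.
    by rewrite pz_scaleE mulrA -pzalgC mulrA.
  by rewrite fZ pzalgM pz_scaleE mulrA.
have lift0 : tens_lift b 0 = 0.
  by apply: (addrI (tens_lift b 0)); rewrite -tens_liftD // !addr0.
have := lift0; rewrite -{1}sum0 (big_morph _ (tens_liftD bb) lift0).
by under eq_bigr => j _ do rewrite tens_liftE //.
Qed.

Variables (n m : nat) (M : 'M[R]_(n, m)).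

(** The two tensor factors commute with each other, so the entries of [M] can be gathered on the
    left without changing their order; [R] itself may be noncommutative. *)
Lemma mul_scalar_op_tens_col (k : nat) (C : 'M[K]_(k, n * n)) (x : 'I_m -> S) p :
  let Y := \col_i \sum_j tens (M i j) 1 * tens 1 (x j) in
  (scalar_op _ C *m (Y *t Y)) p 0 =
  \sum_q tens ((scalar_op R C *m (M *t M)) p q)
              (x (mxtens_unindex q).1 * x (mxtens_unindex q).2).
Proof.
move=> Y; have YY i : (Y *t Y) i 0 = \sum_q tens ((M *t M) i q)
    (x (mxtens_unindex q).1 * x (mxtens_unindex q).2).
  rewrite !mxE mulr_sum; apply: eq_bigr => q _.
  by rewrite !mxE !tensM !mul1r !mulr1.
rewrite mxE; under eq_bigr => i _ do rewrite YY mulr_sumr.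
rewrite exchange_big; apply: eq_bigr => q _; rewrite mxE tens_suml.
by apply: eq_bigr => i _; rewrite !mxE tensM mul1r.
Qed.

Lemma mul_tens_row_scalar_op (k : nat) (C : 'M[K]_(m * m, k)) (x : 'I_n -> S) q :
  let Phi := \row_j \sum_i tens 1 (x i) * tens (M i j) 1 in
  (Phi *t Phi *m scalar_op _ C) 0 q =
  \sum_p tens ((M *t M *m scalar_op R C) p q)
              (x (mxtens_unindex p).1 * x (mxtens_unindex p).2).
Proof.
move=> Phi; have PP j : (Phi *t Phi) 0 j = \sum_p tens ((M *t M) p j)
    (x (mxtens_unindex p).1 * x (mxtens_unindex p).2).
  rewrite !mxE mulr_sum; apply: eq_bigr => p _.
  by rewrite !mxE !tensM !mul1r !mulr1.
rewrite mxE; under eq_bigr => j _ do rewrite PP mulr_suml.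
rewrite exchange_big; apply: eq_bigr => p _; rewrite mxE tens_suml.
by apply: eq_bigr => j _; rewrite !mxE tensM mulr1.
Qed.
End TensorTheory.

(** * The vanishing criterion for tensors with quadratic second factor *)

Section QuadraticTensor.
Variables (K : comNzRingType) (R : pzAlgType K) (n : nat).
Variables (S : {malg K[{fmonom 'I_n}]} -> Prop).
Local Notation Q := (quot_ring S).

Definition quot_gen2 (q : 'I_(n * n)) : Q :=
  quot_pi S (free_gen K (mxtens_unindex q).1)
  * quot_pi S (free_gen K (mxtens_unindex q).2).

Lemma quot_gen2E q : quot_gen2 q = quot_pi S
  (free_gen K (mxtens_unindex q).1 * free_gen K (mxtens_unindex q).2).
Proof. by rewrite quot_piM. Qed.

Lemma sum_mxtens (V : nmodType) (F : 'I_n -> 'I_n -> V) :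
  \sum_i \sum_j F i j = \sum_q F (mxtens_unindex q).1 (mxtens_unindex q).2.
Proof.
rewrite pair_big; apply: reindex => /=.
by exists (@mxtens_index n n) => i _; rewrite (mxtens_indexK, mxtens_unindexK).
Qed.

Lemma quadratic_free_gen2 (i j : 'I_n) :
  quadratic (free_gen K i * free_gen K j).
Proof.
by split=> [|a]; rewrite mcoeff_free_gen2 // !eqseq_cons andbF.
Qed.

Lemma quadratic_form_quadratic (d : 'I_n -> 'I_n -> K) :
  quadratic (\sum_i \sum_j d i j *: (free_gen K i * free_gen K j)).
Proof.
split=> [|a]; rewrite raddf_sum big1 // => i _; rewrite raddf_sum big1 // => j _;
have [q0 q1] := quadratic_free_gen2 i j.
  by rewrite /= mcoeffZ q0 mulr0.
by rewrite /= mcoeffZ q1 mulr0.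
Qed.

Lemma quad_functional_form (c : 'I_(n * n) -> K) (d : 'I_n -> 'I_n -> K) :
  quad_functional c (\sum_i \sum_j d i j *: (free_gen K i * free_gen K j)) =
  \sum_q c q * d (mxtens_unindex q).1 (mxtens_unindex q).2.
Proof.
have f0 : quad_functional c 0 = 0.
  by rewrite /quad_functional big1 // => q _; rewrite mcoeff0 mulr0.
rewrite sum_mxtens (big_morph _ (quad_functionalD c) f0).
apply: eq_bigr => q _; rewrite quad_functionalZ quad_functional_gen2.
exact: mulrC.
Qed.

Lemma quot_pi_form (d : 'I_n -> 'I_n -> K) :
  quot_pi S (\sum_i \sum_j d i j *: (free_gen K i * free_gen K j)) =
  \sum_q pzalg (d (mxtens_unindex q).1 (mxtens_unindex q).2) * quot_gen2 q.
Proof.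
rewrite sum_mxtens (big_morph _ (@quot_piD _ S) (quot_pi0 S)).
by apply: eq_bigr => q _; rewrite -mul_malgC quot_piM quot_gen2E.
Qed.

(** The functional given by column [t] of [d] takes the value [d q t] on the [q]-th product, which
    yields the forward direction. Conversely, expanding each product by the third hypothesis and
    moving the scalars to the left factor leaves coefficients that are zero. *)
Lemma tens_quot_gen2_eq0 (d : 'I_(n * n) -> 'I_(n * n) -> K)
    (r : 'I_(n * n) -> R) :
    (forall u, S u -> quadratic u) ->
    (forall t u, S u -> quad_functional (d^~ t) u = 0) ->
    (forall q, quot_gen2 q = \sum_t pzalg (d q t) * quot_gen2 t) ->
  \sum_q tens (r q) (quot_gen2 q) = 0 <->
  forall t, \sum_q pzalg (d q t) * r q = 0.
Proof.
move=> Sq Sf genE; split=> [sum0 t | sum0].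
  have := tens_sum_functional (quot_functionalD Sq (Sf t))
    (quot_functionalZ Sq (Sf t)) sum0.
  move=> fsum0; rewrite -[RHS]fsum0; apply: eq_bigr => q _.
  by rewrite quot_gen2E quot_functional_pi ?quad_functional_gen2 //; apply: Sf.
under eq_bigr => q _ do rewrite genE tens_sumr.
rewrite exchange_big big1 // => t _.
transitivity (tens (\sum_q pzalg (d q t) * r q) (quot_gen2 t)).
  by rewrite tens_suml; apply: eq_bigr => q _; rewrite tensZ.
by rewrite sum0 tens0l.
Qed.
End QuadraticTensor.

(** * The two algebras of the theorem and the comparison with (1) *)

Lemma scalar_op_compl (K : comNzRingType) (T : pzAlgType K) (k : nat)
    (C : 'M[K]_k) : 1%:M - scalar_op T C = scalar_op T (1%:M - C).
Proof.
apply/matrixP=> i j; rewrite !mxE pzalgD pzalgN; congr (_ - _).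
by case: eqP => _; rewrite ?pzalg1 ?pzalg0.
Qed.

Lemma sum_pzalg_compl (K : comNzRingType) (T : pzAlgType K) (k : nat)
    (C : 'M[K]_k) (g : 'I_k -> T) q :
  \sum_r pzalg ((1%:M - C) q r) * g r = g q - \sum_r pzalg (C q r) * g r.
Proof.
transitivity (\sum_r (pzalg (1%:M q r) * g r - pzalg (C q r) * g r)).
  by apply: eq_bigr => r _; rewrite !mxE pzalgD pzalgN mulrBl.
rewrite sumrB (bigD1 q) //= mxE eqxx pzalg1 mul1r big1 ?addr0 // => r.
by rewrite eq_sym => /negPf neq_qr; rewrite mxE neq_qr pzalg0 mul0r.
Qed.

Section Conditions.
Variables (K : comNzRingType) (R : pzAlgType K) (n m : nat).
Variables (A : 'M[K]_(n * n)) (B : 'M[K]_(m * m)) (M : 'M[R]_(n, m)).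

Lemma Xalg_gen2 (q : 'I_(m * m)) :
  quot_gen2 (Xalg_rel B) q =
  \sum_r pzalg ((1%:M - B) q r) * quot_gen2 (Xalg_rel B) r.
Proof.
rewrite -[q]mxtens_unindexK; case: (mxtens_unindex q) => k l; set q' := mxtens_index _.
have rel0 : \sum_r pzalg (B q' r) * quot_gen2 (Xalg_rel B) r = 0.
  transitivity (quot_pi (Xalg_rel B)
    (\sum_i \sum_j entry4 B k l i j *: (free_gen K i * free_gen K j))).
    rewrite quot_pi_form; apply: eq_bigr => r _.
    by rewrite /entry4 -surjective_pairing mxtens_unindexK.
  by apply/quot_piP; apply: gen_ideal_sub; exists k, l.
by rewrite sum_pzalg_compl rel0 subr0.
Qed.

Lemma Xialg_gen2 (q : 'I_(n * n)) :
  quot_gen2 (Xialg_rel A) q = \sum_p pzalg (A p q) * quot_gen2 (Xialg_rel A) p.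
Proof.
rewrite -[q]mxtens_unindexK; case: (mxtens_unindex q) => i j.
transitivity (quot_pi (Xialg_rel A)
    (\sum_k \sum_l entry4 A k l i j *: (free_gen K k * free_gen K l))).
  rewrite quot_gen2E mxtens_indexK; apply/quotP_ideal.
  by apply: gen_ideal_sub; exists i, j.
rewrite quot_pi_form; apply: eq_bigr => p _.
by rewrite /entry4 -surjective_pairing mxtens_unindexK.
Qed.

Lemma mul_scalar_op_YY p :
  (scalar_op _ A *m (Yvec M B *t Yvec M B)) p 0 =
  \sum_q tens ((scalar_op R A *m (M *t M)) p q) (quot_gen2 (Xalg_rel B) q).
Proof. exact: mul_scalar_op_tens_col. Qed.

Lemma mul_PhiPhi_scalar_op (C : 'M[K]_(m * m)) q :
  (Phivec M A *t Phivec M A *m scalar_op _ C) 0 q =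
  \sum_p tens ((M *t M *m scalar_op R C) p q) (quot_gen2 (Xialg_rel A) p).
Proof. exact: mul_tens_row_scalar_op. Qed.

(** The relations are the rows of [B]; pairing them with the columns of [1 - B] gives the entries of
    [B (1 - B) = 0]. *)
Lemma Xalg_tens_eq0 (r : 'I_(m * m) -> R) : B *m B = B ->
  \sum_q tens (r q) (quot_gen2 (Xalg_rel B) q) = 0 <->
  forall t, \sum_q pzalg ((1%:M - B) q t) * r q = 0.
Proof.
move=> idemB; apply: tens_quot_gen2_eq0 Xalg_gen2 => [|t] _ [k [l ->]].
  exact: quadratic_form_quadratic.
have /matrixP/(_ (mxtens_index (k, l)) t) : B *m (1%:M - B) = 0.
  by rewrite mulmxBr mulmx1 idemB subrr.
rewrite quad_functional_form mxE [RHS]mxE => sumB; rewrite -[RHS]sumB.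
apply: eq_bigr => q _.
by rewrite /entry4 -surjective_pairing mxtens_unindexK mulrC.
Qed.

(** The relations are the columns of [1 - A]; pairing them with the rows of [A] gives the entries of
    [A (1 - A) = 0]. *)
Lemma Xialg_tens_eq0 (r : 'I_(n * n) -> R) : A *m A = A ->
  \sum_p tens (r p) (quot_gen2 (Xialg_rel A) p) = 0 <->
  forall t, \sum_p pzalg (A t p) * r p = 0.
Proof.
move=> idemA; apply: tens_quot_gen2_eq0 Xialg_gen2 => [|t] _ [k [l ->]].
  have [g0 g1] := quadratic_free_gen2 K k l.
  have [q0 q1] := quadratic_form_quadratic (fun i j => entry4 A i j k l).
  by split=> [|a]; rewrite mcoeffB ?g0 ?g1 ?q0 ?q1 subr0.
have gen_kl : quad_functional (A t) (free_gen K k * free_gen K l) =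
    A t (mxtens_index (k, l)).
  by rewrite -(quad_functional_gen2 (A t)) mxtens_indexK.
have /matrixP/(_ t (mxtens_index (k, l))) := idemA; rewrite mxE => sumA.
rewrite quad_functionalB quad_functional_form gen_kl -[X in X - _]sumA.
rewrite -sumrB big1 // => p _.
by rewrite /entry4 -surjective_pairing mxtens_unindexK subrr.
Qed.

Lemma mul_compl_scalar_op_eq0 : B *m B = B ->
  scalar_op R A *m (M *t M) *m (1%:M - scalar_op R B) = 0 <->
  scalar_op _ A *m (Yvec M B *t Yvec M B) = 0.
Proof.
move=> idemB; rewrite scalar_op_compl; set N := scalar_op R A *m (M *t M).
have NE p t : (N *m scalar_op R (1%:M - B)) p t =
    \sum_q pzalg ((1%:M - B) q t) * N p q.
  rewrite mxE; apply: eq_bigr => q _.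
  (* Scalars are central, so the right factor [1 - B] can be moved to the left of the entries of
     [N]. *)
  by rewrite pzalgC; congr (_ * _); rewrite mxE.
split=> [/matrixP N0 | /matrixP YY0].
  apply/matrixP=> p o; rewrite [o]ord1 mul_scalar_op_YY mxE.
  by apply/(Xalg_tens_eq0 _ idemB) => t; rewrite -NE N0 mxE.
apply/matrixP=> p t; rewrite NE [RHS]mxE; move: t.
by apply/(Xalg_tens_eq0 _ idemB); rewrite -mul_scalar_op_YY YY0 mxE.
Qed.

(** The factor [C] stays inside the coefficients throughout, so it can be arbitrary; the theorem
    takes [C = 1 - B]. *)
Lemma mul_scalar_op_eq0 (C : 'M[K]_(m * m)) : A *m A = A ->
  scalar_op R A *m (M *t M) *m scalar_op R C = 0 <->
  Phivec M A *t Phivec M A *m scalar_op _ C = 0.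
Proof.
move=> idemA; rewrite -mulmxA; set N := M *t M *m scalar_op R C.
have NE t q : (scalar_op R A *m N) t q = \sum_p pzalg (A t p) * N p q.
  by rewrite mxE; apply: eq_bigr => p _; congr (_ * _); rewrite mxE.
split=> [/matrixP N0 | /matrixP PP0].
  apply/matrixP=> o q; rewrite [o]ord1 mul_PhiPhi_scalar_op mxE.
  by apply/(Xialg_tens_eq0 _ idemA) => t; rewrite -NE N0 mxE.
apply/matrixP=> t q; rewrite NE [RHS]mxE; move: t.
by apply/(Xialg_tens_eq0 _ idemA); rewrite -mul_PhiPhi_scalar_op PP0 mxE.
Qed.
End Conditions.

Theorem proposition2p17 (R : realType) (n m : nat)
    (A : 'M[R[i]]_(n * n)) (B : 'M[R[i]]_(m * m))
    (idemA : A *m A = A) (idemB : B *m B = B)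
    (RR : pzAlgType R[i]) (M : 'M[RR]_(n, m)) :
  let Y := Yvec M B in
  let Phi := Phivec M A in
  [<-> scalar_op RR A *m (M *t M) *m (1%:M - scalar_op RR B) = 0;
       scalar_op _ A *m (Y *t Y) = 0;
       (Phi *t Phi) *m (1%:M - scalar_op _ B) = 0].
Proof.
move=> Y Phi.
have [imp12 imp21] := mul_compl_scalar_op_eq0 A M idemB.
have [imp13 imp31] := mul_scalar_op_eq0 M (1%:M - B) idemA.
rewrite -!scalar_op_compl in imp13 imp31.
(* In the cycle of implications, the one from (2) to (3) passes through (1). *)
by tfae=> // /imp21/imp13.
Qed.
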